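(* 1. The forgetful functor $p_1Cat \to gr_1Cat$ has a left adjoint $X \mapsto \mathcal C_X$. More explicitly, given $X \in gr_1Cat$, there exists an object $\mathcal C_X \in p_1Cat$ such that there is an inclusion $\iota_X : X \hookrightarrow \mathcal C_X$ in $gr_1Cat$ and such that, for any $D \in p_1Cat$ and any $F \in \mathrm{Hom}_{gr_1Cat}(X,D)$, $F$ extends uniquely (along $\iota_X$) to a map $\tilde F \in \mathrm{Hom}_{p_1Cat}(\mathcal C_X, D)$. 2. Let $(\mathcal C, s_0,t_0,*_0) \in p_1Cat$ and let $X_2$ be a set together with maps of sets $s_1,t_1 : X_2 \rightrightarrows \mathcal C$ such that $\sigma_0 s_1 = \sigma_0 t_1$ for all $\sigma_0 \in \{s_0,t_0\}$. Then: (a) The disjoint union $X = X_2 \cup \mathcal C$ is a 2-categorically graded set. (b) There exists $\mathcal F_X \in p_2Cat$ (called the free pre-2-category on $X$) with the following property: there is an inclusion $\iota_X : X \to \mathcal F_X$ in $gr_2Cat$, and if $D \in p_2Cat$ and $F : X \to D$ is a morphism in $gr_2Cat$ such that $F_{|\mathcal C}$ is a map in $p_2Cat$, then $F$ extends uniquely (along $\iota_X$) to a map $\tilde F : \mathcal F_X \to D$ in $p_2Cat$.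
   Context: Everything is small. For $n\ge 0$, an *$n$-categorically graded set* is a set $S$ with maps $s_i,t_i : S \to S$ for $0\le i<n$ such that, whenever $\sigma_i,\rho_i \in \{s_i,t_i\}$: (i) $\rho_i\sigma_i = \sigma_i$ for all $i$; (ii) for all $i<j$ and $\sigma_i\in\{s_i,t_i\}$, $\rho_j\in\{s_j,t_j\}$, $\rho_j\sigma_i=\sigma_i$ and $\sigma_i\rho_j=\sigma_i$. Morphisms are functions preserving all $s_i,t_i$; this gives the category $gr_nCat$. A *pre-$n$-category* is an $n$-categorically graded set $\mathcal A$ together with compositions $*_i : \{(a,b)\in\mathcal A\times\mathcal A : s_i a = t_i b\}\to\mathcal A$ for $0\le i\le n-1$ such that $s_i(a*_i b)=s_i b$, $t_i(a*_i b)=t_i a$, and for $i<j$ and $\rho_j\in\{s_j,t_j\}$, $\rho_j(a*_i b)=\rho_j a *_i \rho_j b$. (No associativity, unit or interchange laws are required.) Morphisms are functions preserving all $s_i,t_i,*_i$; this gives the category $p_nCat$. Morphisms in these categories are called maps; an inclusion is a map injective on underlying sets. A pre-1-category is regarded as a pre-2-category (and a 1-categorically graded set as a 2-categorically graded set) by letting $s_1=t_1=\mathrm{id}$ (so that necessarily $x*_1x=x$); this is the sense in which $\mathcal C$ is an object of $p_2Cat$. In part 2, the structure maps on $X=X_2\cup\mathcal C$ are: on $\mathcal C$, $s_0,t_0$ are those of $\mathcal C$ and $s_1=t_1=\mathrm{id}_{\mathcal C}$; on $X_2$, $s_1,t_1$ are the given maps into $\mathcal C$ and $\sigma_0 :=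 \sigma_0 s_1=\sigma_0 t_1$ for $\sigma_0\in\{s_0,t_0\}$. *)

(* Defs.v *)
From mathcomp Require Import all_boot.
From mathcomp Require Import boolp.

Set Implicit Arguments.
Unset Strict Implicit.
Unset Printing Implicit Defensive.

Record category := Category {
  obj : Type;
  hom : obj -> obj -> Type;
  idm : forall a, hom a a;
  cmp : forall a b c, hom b c -> hom a b -> hom a c;
  cmp1m : forall a b (f : hom a b), cmp (idm b) f = f;
  cmpm1 : forall a b (f : hom a b), cmp f (idm a) = f;
  cmpA : forall a b c d (f : hom c d) (g : hom b c) (h : hom a b),
    cmp f (cmp g h) = cmp (cmp f g) h }.

Arguments idm {c0} a : rename.
Arguments cmp {c0 a b c} f g : rename.

Record functor (C D : category) := Functor {
  fobj :> obj C -> obj D;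
  fmap : forall a b, hom a b -> hom (fobj a) (fobj b);
  fmap1 : forall a, fmap (idm a) = idm (fobj a);
  fmapM : forall a b c (f : hom b c) (g : hom a b),
    fmap (cmp f g) = cmp (fmap f) (fmap g) }.

Arguments fmap {C D} f0 {a b} f : rename.

(* L is left adjoint to R: hom (L x) y ~ hom x (R y), naturally in x and y.   *)
Record adjunction (C D : category) (L : functor C D) (R : functor D C) :=
  Adjunction {
    transpose : forall (x : obj C) (y : obj D), hom (L x) y -> hom x (R y);
    transpose_bij : forall x y, bijective (@transpose x y);
    transpose_natl : forall x x' y (f : hom x' x) (g : hom (L x) y),
      transpose (cmp g (fmap L f)) = cmp (transpose g) f;
    transpose_natr : forall x y y' (h : hom y y') (g : hom (L x) y),
      transpose (cmp h g) = cmp (fmap R h) (transpose g) }.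

Arguments transpose {C D L R} a {x y} g : rename.

Definition unit_of (C D : category) (L : functor C D) (R : functor D C)
    (adj : adjunction L R) (x : obj C) : hom x (R (L x)) :=
  transpose adj (idm (L x)).

(* [bd Src i] and [bd Tgt i] are the maps s_i and t_i.                        *)
Variant side := Src | Tgt.

Record is_graded n (S : Type) (bd : side -> 'I_n -> S -> S) : Prop := IsGraded {
  bd_bd : forall r e i x, bd r i (bd e i x) = bd e i x;
  bd_bdl : forall r e (i j : 'I_n) x, i < j -> bd r j (bd e i x) = bd e i x;
  bd_bdr : forall r e (i j : 'I_n) x, i < j -> bd e i (bd r j x) = bd e i x }.

Record grset n := GrSet {
  carrier :> Type;
  bd : side -> 'I_n -> carrier -> carrier;
  grsetP : is_graded bd }.

Definition is_grmap n (A B : grset n) (f : A -> B) : Prop :=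
  forall e i x, f (bd e i x) = bd e i (f x).

Record grmap n (A B : grset n) := GrMap {
  grfun :> A -> B;
  grmapP : is_grmap grfun }.

(* [pcomp i a b h] is a *_i b.  In [bd_pcomp] (and in [is_premap] below) the  *)
(* composability h' of the right-hand side always holds, by the other laws    *)
(* (see [bd_composable] and [grmap_composable]), and all its proofs are equal.*)
Record precat n := PreCat {
  gr_of :> grset n;
  pcomp : forall (i : 'I_n) (a b : gr_of), bd Src i a = bd Tgt i b -> gr_of;
  src_pcomp : forall i a b (h : bd Src i a = bd Tgt i b),
    bd Src i (pcomp h) = bd Src i b;
  tgt_pcomp : forall i a b (h : bd Src i a = bd Tgt i b),
    bd Tgt i (pcomp h) = bd Tgt i a;
  bd_pcomp : forall r (i j : 'I_n) a b (h : bd Src i a = bd Tgt i b)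
    (h' : bd Src i (bd r j a) = bd Tgt i (bd r j b)),
    i < j -> bd r j (pcomp h) = pcomp h' }.

Arguments pcomp {n} p i a b h : rename.

Lemma bd_composable n (A : grset n) r (i j : 'I_n) (a b : A) :
  i < j -> bd Src i a = bd Tgt i b ->
  bd Src i (bd r j a) = bd Tgt i (bd r j b).
Proof. by move=> ij h; rewrite !(bd_bdr (grsetP A)). Qed.

Definition is_premap n (A B : precat n) (f : A -> B) : Prop :=
  is_grmap f /\
  forall i a b (h : bd Src i a = bd Tgt i b)
    (h' : bd Src i (f a) = bd Tgt i (f b)),
    f (pcomp A i a b h) = pcomp B i (f a) (f b) h'.

Lemma grmap_composable n (A B : grset n) (f : A -> B) i (a b : A) :
  is_grmap f -> bd Src i a = bd Tgt i b -> bd Src i (f a) = bd Tgt i (f b).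
Proof. by move=> fP h; rewrite -!fP h. Qed.

Record premap n (A B : precat n) := PreMap {
  prefun :> A -> B;
  premapP : is_premap prefun }.

Lemma grmap_eq n (A B : grset n) (f g : grmap A B) : f =1 g -> f = g.
Proof.
case: f g => [f fP] [g gP] /= /funext fg; move: fP gP.
by rewrite fg => fP gP; congr GrMap; apply: Prop_irrelevance.
Qed.

Lemma premap_eq n (A B : precat n) (f g : premap A B) : f =1 g -> f = g.
Proof.
case: f g => [f fP] [g gP] /= /funext fg; move: fP gP.
by rewrite fg => fP gP; congr PreMap; apply: Prop_irrelevance.
Qed.

Lemma is_grmap_id n (A : grset n) : is_grmap (fun x : A => x).
Proof. by []. Qed.

Lemma is_grmap_comp n (A B C : grset n) (f : grmap B C) (g : grmap A B) :
  is_grmap (fun x => f (g x)).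
Proof. by move=> e i x; rewrite !grmapP. Qed.

Lemma is_premap_id n (A : precat n) : is_premap (fun x : A => x).
Proof. by split=> // i a b h h'; congr pcomp; apply: Prop_irrelevance. Qed.

Lemma is_premap_comp n (A B C : precat n) (f : premap B C) (g : premap A B) :
  is_premap (fun x => f (g x)).
Proof.
case: f g => [f [fg fM]] [g [gg gM]] /=.
split=> [e i x|i a b h h']; first by rewrite gg fg.
by rewrite (gM _ _ _ h (grmap_composable gg h)) (fM _ _ _ _ h').
Qed.

Definition grCat (n : nat) : category.
Proof.
refine (@Category (grset n) (@grmap n) (fun A => GrMap (@is_grmap_id n A))
  (fun A B C f g => GrMap (is_grmap_comp f g)) _ _ _).
- by move=> A B f; apply: grmap_eq.
- by move=> A B f; apply: grmap_eq.
- by move=> A B C D f g h; apply: grmap_eq.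
Defined.

Definition pCat (n : nat) : category.
Proof.
refine (@Category (precat n) (@premap n) (fun A => PreMap (@is_premap_id n A))
  (fun A B C f g => PreMap (is_premap_comp f g)) _ _ _).
- by move=> A B f; apply: premap_eq.
- by move=> A B f; apply: premap_eq.
- by move=> A B C D f g h; apply: premap_eq.
Defined.

Definition forget_map n (A B : precat n) (f : premap A B) : grmap A B :=
  GrMap (proj1 (premapP f)).

Definition forget (n : nat) : functor (pCat n) (grCat n).
Proof.
refine (@Functor (pCat n) (grCat n) (@gr_of n) (@forget_map n) _ _).
- by move=> A; apply: grmap_eq.
- by move=> A B C f g; apply: grmap_eq.
Defined.

(* A pre-1-category regarded as a pre-2-category, with s_1 = t_1 = id; the    *)
(* composite a *_1 b is defined only for a = b, with value a.  The auxiliary  *)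
(* functions take the index as a natural number so as to compute.             *)
Section AsPre2.
Variable C : precat 1.

Definition as2_bd_nat (e : side) (k : nat) : C -> C :=
  if k is 0 then bd e ord0 else id.

Definition as2_bd (e : side) (i : 'I_2) : C -> C := as2_bd_nat e i.

Definition as2_pcomp_nat (k : nat) :
    forall a b : C, as2_bd_nat Src k a = as2_bd_nat Tgt k b -> C :=
  match k with
  | 0 => fun a b h => pcomp C ord0 a b h
  | _.+1 => fun a _ _ => a
  end.

Lemma as2_graded : is_graded as2_bd.
Proof.
split=> r e [[|[|//]] ?] => [x|x|[[|[|//]] ?] x ij|[[|[|//]] ?] x ij|
  [[|[|//]] ?] x ij|[[|[|//]] ?] x ij] //=.
exact: bd_bd (grsetP C) _ _ _ _.
Qed.

Definition as2_gr : grset 2 := GrSet as2_graded.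

Definition as2_pcomp (i : 'I_2) (a b : as2_gr) :
    bd Src i a = bd Tgt i b -> as2_gr :=
  @as2_pcomp_nat i a b.

Lemma as2_src_pcomp i a b (h : bd Src i a = bd Tgt i b) :
  bd Src i (as2_pcomp h) = bd Src i b.
Proof. by case: i h => [[|[|//]] ?] h //=; apply: src_pcomp. Qed.

Lemma as2_tgt_pcomp i a b (h : bd Src i a = bd Tgt i b) :
  bd Tgt i (as2_pcomp h) = bd Tgt i a.
Proof. by case: i h => [[|[|//]] ?] h //=; apply: tgt_pcomp. Qed.

Lemma as2_bd_pcomp r (i j : 'I_2) a b (h : bd Src i a = bd Tgt i b)
    (h' : bd Src i (bd r j a) = bd Tgt i (bd r j b)) :
  i < j -> bd r j (as2_pcomp h) = as2_pcomp h'.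
Proof.
case: i j h h' => [[|[|//]] ?] [[|[|//]] ?] h h' //= _.
by rewrite /as2_pcomp /=; congr pcomp; apply: Prop_irrelevance.
Qed.

Definition as_pre2 : precat 2 :=
  PreCat as2_src_pcomp as2_tgt_pcomp as2_bd_pcomp.

End AsPre2.

(* On X2, s_0 and t_0 go through s1; going through t1 gives the same maps     *)
(* under the hypothesis that sigma_0 s1 = sigma_0 t1.                         *)
Definition union_bd (C : precat 1) (X2 : Type) (s1 t1 : X2 -> C)
    (e : side) (i : 'I_2) (x : X2 + C) : X2 + C :=
  match x, val i with
  | inl y, 0 => inr (bd e ord0 (s1 y))
  | inl y, _ => inr (if e is Src then s1 y else t1 y)
  | inr c, 0 => inr (bd e ord0 c)
  | inr c, _ => inr c
  end.

(* Main.v *)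
From mathcomp Require Import all_boot.
From mathcomp Require Import boolp.
Require Import Defs.

(** Both parts are instances of one construction.  A partial pre-n-category
    is a graded set on which some of the composable pairs have a prescribed
    composite, compatibly with sources and targets; the claim is that it embeds
    universally into a pre-n-category in which all composable pairs compose.
    Part 1 is the case where nothing is prescribed, and in part 2 the prescribed
    composites are those of C, with c *_1 c = c included.

    The completion consists of formal composites (binary trees with leaves in
    the given graded set), and no quotient is required: orienting each
    prescribed equation x *_i y = z from left to right gives a rewriting system
    whose left-hand sides are composites of two leaves and whose right-hand
    sides are leaves, so the composite of two normal forms is already normal
    except that it may collapse at its root ([mul]).  The completion is thus the
    set of normal forms all of whose nodes are composable ([wf]), a leaf is
    normal, and distinct leaves are distinct elements; this is why the unit is
    injective.

    The boundaries of a composite are forced by the axioms ([tbd]): those above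
    the direction of composition act on both factors, the others see only one
    factor.  That these boundaries satisfy the globular identities is an
    induction on trees whose crucial case uses composability ([tbd_low]).  A map
    to D extends by evaluating trees in D, and uniquely so because every tree is
    built from leaves by composition. *)

Set Implicit Arguments.
Unset Strict Implicit.
Unset Printing Implicit Defensive.

(** * Composition in a pre-n-category *)

Lemma bd_low n (A : grset n) e (i k : 'I_n) (a b : A) :
  i < k -> bd Src k a = bd Tgt k b -> bd e i a = bd e i b.
Proof.
move=> ik h.
by rewrite -(bd_bdr (grsetP A) Src e a ik) h (bd_bdr (grsetP A)).
Qed.

(** With the two axioms on the boundaries of a composite in its own direction,
    this determines all the boundaries of a composite. *)
Lemma bd_pcomp_le n (A : precat n) r (i j : 'I_n) (a b : A)
    (h : bd Src i a = bd Tgt i b) :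
  j <= i -> bd r j (pcomp A i a b h) = bd r j (if r is Src then b else a).
Proof.
rewrite leq_eqVlt => /orP[/eqP/val_inj->|ji].
  by case: r; [apply: src_pcomp | apply: tgt_pcomp].
have -> : bd r j (pcomp A i a b h) = bd r j b.
  by rewrite -(bd_bdr (grsetP A) Src r _ ji) src_pcomp (bd_bdr (grsetP A)).
by case: r => //; rewrite (bd_low _ ji h).
Qed.

(** A total composition, so that formal composites can be evaluated without
    carrying composability proofs along; the value on non-composable pairs is
    arbitrary. *)
Definition pcompt n (A : precat n) (i : 'I_n) (a b : A) : A :=
  if pselect (bd Src i a = bd Tgt i b) is left h then pcomp A i a b h else a.

Lemma pcomptE n (A : precat n) (i : 'I_n) (a b : A)
  (h : bd Src i a = bd Tgt i b) : pcompt i a b = pcomp A i a b h.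
Proof.
by rewrite /pcompt; case: pselect => // h'; congr pcomp; apply: Prop_irrelevance.
Qed.

(** * Partial pre-n-categories *)

(** [pop i x y = Some z] prescribes x *_i y = z.  By [bd_pop] the domain of
    definition is stable under the higher boundaries. *)
Record partial_precat n := PartialPreCat {
  pgr :> grset n;
  pop : 'I_n -> pgr -> pgr -> option pgr;
  pop_composable : forall i x y z,
    pop i x y = Some z -> bd Src i x = bd Tgt i y;
  src_pop : forall i x y z, pop i x y = Some z -> bd Src i z = bd Src i y;
  tgt_pop : forall i x y z, pop i x y = Some z -> bd Tgt i z = bd Tgt i x;
  bd_pop : forall r (i j : 'I_n) x y z, i < j ->
    pop i x y = Some z -> pop i (bd r j x) (bd r j y) = Some (bd r j z) }.

Definition preserves_pop n (P : partial_precat n) (D : precat n) (F : P -> D) :=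
  forall i x y z, pop i x y = Some z ->
  forall h : bd Src i (F x) = bd Tgt i (F y), F z = pcomp D i (F x) (F y) h.

Lemma bd_pop_le n (P : partial_precat n) r (i j : 'I_n) (x y z : P) :
  j <= i -> pop i x y = Some z -> bd r j z = bd r j (if r is Src then y else x).
Proof.
rewrite leq_eqVlt => /orP[/eqP/val_inj->|ji] xyz.
  by case: r; [apply: src_pop xyz | apply: tgt_pop xyz].
have -> : bd r j z = bd r j y.
  by rewrite -(bd_bdr (grsetP P) Src r _ ji) (src_pop xyz) (bd_bdr (grsetP P)).
by case: r => //; rewrite (bd_low _ ji (pop_composable xyz)).
Qed.

(** * Formal composites in normal form *)

Section Completion.
Variables (n : nat) (P : partial_precat n).

Inductive term := Var of P | Comp of 'I_n & term & term.

Definition mul (i : 'I_n) (a b : term) : term :=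
  match a, b with
  | Var x, Var y => if pop i x y is Some z then Var z else Comp i a b
  | _, _ => Comp i a b
  end.

(** For j < i the two factors of a composable pair have the same j-boundaries,
    so either may be chosen; choosing by the side r, as the axioms impose for
    j = i, treats both cases at once.  For i < j the recursive composite may
    become reducible, whence [mul]. *)
Fixpoint tbd (r : side) (j : 'I_n) (t : term) : term :=
  match t with
  | Var x => Var (bd r j x)
  | Comp i a b =>
      if i < j then mul i (tbd r j a) (tbd r j b)
      else if r is Src then tbd r j b else tbd r j a
  end.

(** The last condition says that the node is irreducible. *)
Fixpoint wf (t : term) : Prop :=
  match t with
  | Var _ => True
  | Comp i a b =>
      [/\ wf a, wf b, tbd Src i a = tbd Tgt i b & mul i a b = Comp i a b]
  end.

Variant mul_spec i : term -> term -> term -> Prop :=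
| MulPop x y z of pop i x y = Some z : mul_spec i (Var x) (Var y) (Var z)
| MulComp a b of mul i a b = Comp i a b : mul_spec i a b (Comp i a b).

Lemma mulP i a b : mul_spec i a b (mul i a b).
Proof.
case mulE: (mul i a b) => [z|k a' b'].
  case: a b mulE => [x|? ? ?] [y|? ? ?] //=.
  by case xyz: (pop i x y) => [w|] // [<-]; apply: MulPop.
have E : mul i a b = Comp i a b.
  by case: a b mulE => [x|? ? ?] [y|? ? ?] //=; case: (pop i x y).
by rewrite -mulE E; apply: MulComp.
Qed.

(** Boundaries do not distinguish a redex from its contractum: this is where
    the laws of the prescribed composites enter. *)
Lemma tbd_mul r j i a b : tbd r j (mul i a b) = tbd r j (Comp i a b).
Proof.
case: mulP => //= x y z xyz; case: ltnP => ij.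
  by rewrite (bd_pop r ij xyz).
by rewrite (bd_pop_le r ij xyz); case: r.
Qed.

Lemma wf_mul i a b :
  wf a -> wf b -> tbd Src i a = tbd Tgt i b -> wf (mul i a b).
Proof. by case: mulP. Qed.

Lemma tbd_tbd r e i t : tbd r i (tbd e i t) = tbd e i t.
Proof.
elim: t => [x|k a IHa b IHb] /=; first by rewrite (bd_bd (grsetP P)).
by case: ifPn => ki; [rewrite tbd_mul /= ki IHa IHb | case: e IHa IHb].
Qed.

Lemma tbd_tbdl r e (i j : 'I_n) t :
  i < j -> tbd r j (tbd e i t) = tbd e i t.
Proof.
move=> ij; elim: t => [x|k a IHa b IHb] /=.
  by rewrite (bd_bdl (grsetP P)).
case: ifPn => ki; last by case: e IHa IHb.
by rewrite tbd_mul /= (ltn_trans ki ij) IHa IHb.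
Qed.

(** The instance of [bd_low] for terms, isolated from the induction that makes
    it available: the globular identity is supplied for the two factors. *)
Lemma tbd_low e (i k : 'I_n) a b :
  tbd e i (tbd Src k a) = tbd e i a -> tbd e i (tbd Tgt k b) = tbd e i b ->
  tbd Src k a = tbd Tgt k b -> tbd e i a = tbd e i b.
Proof. by move=> <- <- ->. Qed.

(** For directions i < j <= k the outer boundary of a *_k b may be computed
    from one factor on the left-hand side and from the other factor on the
    right-hand side; composability reconciles them. *)
Lemma tbd_tbdr r e (i j : 'I_n) t :
  i < j -> wf t -> tbd e i (tbd r j t) = tbd e i t.
Proof.
elim: t r j => [x|k a IHa b IHb] r j ij /=.
  by rewrite (bd_bdr (grsetP P)).
case=> wa wb ab _; case: (ltnP k j) => kj.
  by rewrite tbd_mul /= IHa // IHb.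
have ik := leq_trans ij kj.
have {}ab : tbd e i a = tbd e i b by apply: (tbd_low _ _ ab); rewrite ?IHa ?IHb.
rewrite ltnNge (ltnW ik) /=.
by case: r; case: e ab IHa IHb => ab IHa IHb; rewrite ?IHa ?IHb.
Qed.

Lemma wf_tbd r j t : wf t -> wf (tbd r j t).
Proof.
elim: t => [//|k a IHa b IHb] /= [wa wb ab _].
case: ifP => kj; last by case: r IHa IHb => IHa IHb; auto.
by apply: wf_mul; [exact: IHa | exact: IHb | rewrite !tbd_tbdr].
Qed.

(** * The completion of a partial pre-n-category *)

Lemma wf_term_inj (a b : {t | wf t}) : sval a = sval b -> a = b.
Proof.
by case: a b => [a wa] [b wb] /= ab; case: b / ab wb => wb; congr exist;
  apply: Prop_irrelevance.
Qed.

Definition completion_bd (r : side) (j : 'I_n) (t : {t | wf t}) : {t | wf t} :=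
  exist _ (tbd r j (sval t)) (wf_tbd r j (svalP t)).

Lemma completion_graded : is_graded completion_bd.
Proof.
split=> [r e i|r e i j|r e i j] [t wt] => [|ij|ij]; apply: wf_term_inj => /=.
- exact: tbd_tbd.
- exact: tbd_tbdl.
- exact: tbd_tbdr.
Qed.

Definition completion_gr : grset n := GrSet completion_graded.

Definition completion_pcomp i (a b : completion_gr)
    (h : bd Src i a = bd Tgt i b) : completion_gr :=
  exist _ (mul i (sval a) (sval b))
    (wf_mul (svalP a) (svalP b) (congr1 sval h)).

Lemma completion_src_pcomp i a b (h : bd Src i a = bd Tgt i b) :
  bd Src i (completion_pcomp h) = bd Src i b.
Proof. by apply: wf_term_inj; rewrite /= tbd_mul /= ltnn. Qed.

Lemma completion_tgt_pcomp i a b (h : bd Src i a = bd Tgt i b) :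
  bd Tgt i (completion_pcomp h) = bd Tgt i a.
Proof. by apply: wf_term_inj; rewrite /= tbd_mul /= ltnn. Qed.

Lemma completion_bd_pcomp r (i j : 'I_n) a b (h : bd Src i a = bd Tgt i b)
    (h' : bd Src i (bd r j a) = bd Tgt i (bd r j b)) :
  i < j -> bd r j (completion_pcomp h) = completion_pcomp h'.
Proof. by move=> ij; apply: wf_term_inj; rewrite /= tbd_mul /= ij. Qed.

Definition completion : precat n :=
  PreCat completion_src_pcomp completion_tgt_pcomp completion_bd_pcomp.

Definition completion_var (x : P) : completion := exist _ (Var x) I.

Lemma completion_var_grmap : is_grmap completion_var.
Proof. by move=> e i x; apply: wf_term_inj. Qed.

Definition completion_unit : grmap P completion := GrMap completion_var_grmap.

Lemma completion_unit_inj : injective completion_unit.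
Proof. by move=> x y /(congr1 sval) []. Qed.

Lemma completion_unit_pop : preserves_pop completion_unit.
Proof. by move=> i x y z xyz h; apply: wf_term_inj; rewrite /= xyz. Qed.

(** * The universal property *)

Section Extension.
Variables (D : precat n) (F : grmap P D).
Hypothesis F_pop : preserves_pop F.

Fixpoint eval (t : term) : D :=
  match t with
  | Var x => F x
  | Comp i a b => pcompt i (eval a) (eval b)
  end.

Lemma eval_mul i a b : eval (mul i a b) = pcompt i (eval a) (eval b).
Proof.
case: mulP => //= x y z xyz.
have h := grmap_composable (@grmapP _ _ _ F) (pop_composable xyz).
by rewrite (pcomptE h); apply: F_pop.
Qed.

(** Composability of the values of the two factors, without which [pcompt] is
    meaningless, follows from the statement for the factors. *)
Lemma eval_tbd r j t : wf t -> eval (tbd r j t) = bd r j (eval t).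
Proof.
elim: t r j => [x|i a IHa b IHb] r j /=; first by rewrite grmapP.
case=> wa wb ab _.
have h : bd Src i (eval a) = bd Tgt i (eval b) by rewrite -IHa // ab IHb.
rewrite (pcomptE h); case: ltnP => ij; last first.
  by rewrite (bd_pcomp_le r h ij); case: r; [apply: IHb | apply: IHa].
rewrite eval_mul IHa // IHb //.
by rewrite (pcomptE (bd_composable r ij h)) (bd_pcomp _ (bd_composable r ij h)).
Qed.

Lemma eval_premap : is_premap (fun t : completion => eval (sval t)).
Proof.
split=> [e i [t wt]|i a b h h'] /=; first exact: eval_tbd.
by rewrite eval_mul (pcomptE h').
Qed.

Definition extension : premap completion D := PreMap eval_premap.

End Extension.

(** A normal form with a composition node is, in the completion, the composite
    of its two subtrees, because that node is irreducible. *)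
Lemma premap_completion_ext (D : precat n) (f g : premap completion D) :
  (forall x, f (completion_unit x) = g (completion_unit x)) -> f = g.
Proof.
move=> fg; apply: premap_eq; case=> t; elim: t => [x|i a IHa b IHb] wt.
  suff -> : exist _ _ wt = completion_unit x by apply: fg.
  exact: wf_term_inj.
have [wa wb ab abE] := wt.
pose a' : completion := exist _ a wa; pose b' : completion := exist _ b wb.
have h : bd Src i a' = bd Tgt i b' by apply: wf_term_inj.
have -> : exist _ _ wt = pcomp completion i a' b' h by apply: wf_term_inj.
have [[fgr fM] [ggr gM]] := (premapP f, premapP g).
rewrite (fM _ _ _ h (grmap_composable fgr h)) -(pcomptE (grmap_composable fgr h)).
rewrite (gM _ _ _ h (grmap_composable ggr h)) -(pcomptE (grmap_composable ggr h)).
by rewrite (IHa wa) (IHb wb).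
Qed.

Lemma completion_universal (D : precat n) (F : grmap P D) :
  preserves_pop F ->
  exists! Ft : premap completion D, forall x, Ft (completion_unit x) = F x.
Proof.
move=> F_pop; exists (extension F_pop); split=> // G GF.
by apply: premap_completion_ext => x; rewrite GF.
Qed.

End Completion.

(** * The free pre-n-category on a graded set *)

Definition discrete n (X : grset n) : partial_precat n.
Proof. by refine (@PartialPreCat n X (fun _ _ _ => None) _ _ _ _). Defined.

Lemma preserves_pop_discrete n (X : grset n) (D : precat n) (F : X -> D) :
  @preserves_pop n (discrete X) D F.
Proof. by []. Qed.

Definition free_precat n (X : grset n) : precat n := completion (discrete X).

Definition free_unit n (X : grset n) : grmap X (free_precat X) :=
  completion_unit (discrete X).

Definition free_extension n (X : grset n) (D : precat n) (F : grmap X D) :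
    premap (free_precat X) D :=
  extension (@preserves_pop_discrete n X D F).

Definition free_map n (X Y : grset n) (f : grmap X Y) :
    premap (free_precat X) (free_precat Y) :=
  free_extension (GrMap (is_grmap_comp (free_unit Y) f)).

Definition free (n : nat) : functor (grCat n) (pCat n).
Proof.
refine (@Functor (grCat n) (pCat n) (@free_precat n) (@free_map n) _ _).
- by move=> X; apply: premap_completion_ext.
- by move=> X Y Z f g; apply: premap_completion_ext.
Defined.

Definition free_transpose n (X : grset n) (D : precat n)
    (g : premap (free_precat X) D) : grmap X D :=
  GrMap (is_grmap_comp (forget_map g) (free_unit X)).

Lemma free_transpose_bij n (X : grset n) (D : precat n) :
  bijective (@free_transpose n X D).
Proof.
exists (@free_extension n X D) => [g|F]; last exact: grmap_eq.
exact: premap_completion_ext.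
Qed.

Definition free_adjunction n : adjunction (free n) (forget n).
Proof.
refine (@Adjunction _ _ (free n) (forget n) (@free_transpose n)
  (@free_transpose_bij n) _ _).
- by move=> X X' D f g; apply: grmap_eq.
- by move=> X D D' h g; apply: grmap_eq.
Defined.

(** * Adjoining 2-cells to a pre-1-category *)

Section Adjoin.
Variables (C : precat 1) (X2 : Type) (s1 t1 : X2 -> C).
Hypothesis st1 : forall e x, bd e ord0 (s1 x) = bd e ord0 (t1 x).

Lemma union_bd_inr e i (c : C) :
  union_bd s1 t1 e i (inr c) = inr (bd e i (c : as_pre2 C)).
Proof. by case: i => [[|[|//]] ?]. Qed.

Lemma union_graded : is_graded (union_bd s1 t1).
Proof.
have [bb bl br] := grsetP (as_pre2 C).
split=> [r e i|r e i j|r e i j] [y|c] => [||ij|ij|ij|ij].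
- by case: i => [[|[|//]] ?]; rewrite /union_bd //= (bd_bd (grsetP C)).
- by rewrite !union_bd_inr bb.
- by case: i j ij => [[|[|//]] ?] [[|[|//]] ?].
- by rewrite !union_bd_inr bl.
- case: i j ij => [[|[|//]] ?] [[|[|//]] ?] //= _.
  (* The 0-boundaries of a 2-cell go through s1, those of its 1-target
     through t1. *)
  by case: r; rewrite ?st1.
- by rewrite !union_bd_inr br.
Qed.

Definition union_gr : grset 2 := GrSet union_graded.

Lemma bd_union_inr e i (c : C) :
  @bd 2 union_gr e i (inr c) = inr (bd e i (c : as_pre2 C)).
Proof. exact: union_bd_inr. Qed.

(** All the composites of C as a pre-2-category are prescribed, hence also
    c *_1 c = c. *)
Definition union_pop (i : 'I_2) (x y : union_gr) : option union_gr :=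
  match x, y with
  | inr c, inr d =>
      if pselect (bd Src i (c : as_pre2 C) = bd Tgt i (d : as_pre2 C)) is left h
      then Some (inr (pcomp (as_pre2 C) i c d h)) else None
  | _, _ => None
  end.

Variant union_pop_spec i : union_gr -> union_gr -> union_gr -> Prop :=
| UnionPop (c d : as_pre2 C) (h : bd Src i c = bd Tgt i d) :
    union_pop_spec i (inr c) (inr d) (inr (pcomp (as_pre2 C) i c d h)).

Lemma union_popP i x y z : union_pop i x y = Some z -> union_pop_spec i x y z.
Proof.
by case: x y => [?|c] [?|d] //=; case: pselect => // h [<-]; apply: UnionPop.
Qed.

Lemma union_popE i (c d : as_pre2 C) (h : bd Src i c = bd Tgt i d) :
  union_pop i (inr c) (inr d) = Some (inr (pcomp (as_pre2 C) i c d h)).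
Proof.
rewrite /union_pop; case: pselect => // h'.
by rewrite (Prop_irrelevance h h').
Qed.

Definition union_partial : partial_precat 2.
Proof.
refine (@PartialPreCat 2 union_gr union_pop _ _ _ _).
- by move=> i x y z /union_popP[c d h]; rewrite !bd_union_inr h.
- by move=> i x y z /union_popP[c d h]; rewrite !bd_union_inr src_pcomp.
- by move=> i x y z /union_popP[c d h]; rewrite !bd_union_inr tgt_pcomp.
- move=> r i j x y z ij /union_popP[c d h]; rewrite !bd_union_inr.
  have h' := bd_composable r ij h.
  by rewrite (union_popE h') (bd_pcomp h h' ij).
Defined.

Lemma premap_preserves_union_pop (D : precat 2) (F : union_gr -> D) :
  @is_premap 2 (as_pre2 C) D (fun c : C => F (inr c)) ->
  @preserves_pop 2 union_partial D F.
Proof.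
by move=> [_ FM] i x y z /union_popP[c d h] h'; apply: (FM i c d h h').
Qed.

Lemma preserves_union_pop_premap (D : precat 2) (F : grmap union_gr D) :
  @preserves_pop 2 union_partial D F ->
  @is_premap 2 (as_pre2 C) D (fun c : C => F (inr c)).
Proof.
move=> F_pop; split=> [e i c|i c d h h'].
  by rewrite -grmapP bd_union_inr.
exact: F_pop (union_popE h) h'.
Qed.

End Adjoin.

Theorem lemma2p2 :
  (exists (L : functor (grCat 1) (pCat 1)) (adj : adjunction L (forget 1)),
     forall X : grset 1,
       let CX : precat 1 := L X in
       let iota : grmap X CX := unit_of adj X in
       injective iota /\
       forall (D : precat 1) (F : grmap X D),
         exists! Ft : premap CX D, forall x : X, Ft (iota x) = F x)
  /\
  (forall (C : precat 1) (X2 : Type) (s1 t1 : X2 -> C),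
     (forall (e : side) (x : X2), bd e ord0 (s1 x) = bd e ord0 (t1 x)) ->
     exists X_graded : is_graded (union_bd s1 t1),
       let X : grset 2 := GrSet X_graded in
       exists (FX : precat 2) (iota : grmap X FX),
         [/\ injective iota,
             @is_premap 2 (as_pre2 C) FX (fun c : C => iota (inr c))
           & forall (D : precat 2) (F : grmap X D),
               @is_premap 2 (as_pre2 C) D (fun c : C => F (inr c)) ->
               exists! Ft : premap FX D, forall x : X, Ft (iota x) = F x]).
Proof.
split.
  exists (free 1), (free_adjunction 1) => X CX iota.
  have -> : iota = free_unit X by apply: grmap_eq.
  split=> [|D F]; first exact: completion_unit_inj.
  exact: completion_universal (@preserves_pop_discrete 1 X D F).
move=> C X2 s1 t1 st1; exists (union_graded st1) => /=.
pose P := union_partial st1.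
exists (completion P), (completion_unit P); split.
- exact: completion_unit_inj.
- exact: preserves_union_pop_premap (@completion_unit_pop 2 P).
- move=> D F /premap_preserves_union_pop.
  exact: completion_universal.
Qed.
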